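(* Let $U$ be a finite set of angles, considered modulo $\pi$, with $0\in U$. Let $n$ be the highest order of a rotation in the point group $P(U)$. (1) If $n>2$, then $P(U)$ is cyclic of order $n$ if it contains no reflections, and is isomorphic to the dihedral group of a regular polygon with $n$ vertices (the group of order $2n$) if it contains reflections. (2) If $n=2$, then $P(U)$ is cyclic of order $2$ if it contains no reflections, and is isomorphic to $\mathbb{Z}/2\mathbb{Z}\times\mathbb{Z}/2\mathbb{Z}$ if it contains reflections.
   Context: Identify $\mathbb{C}$ with $\mathbb{R}^2$. For $p\in\mathbb{C}$ and an angle $\alpha$, let $L_{p,\alpha}=\{p+r(\cos\alpha+i\sin\alpha): r\in\mathbb{R}\}$. For $p,q\in\mathbb{C}$ and distinct angles $\alpha\ne\beta$ (mod $\pi$), $[\![p,q]\!]_{\alpha,\beta}$ denotes the intersection point of $L_{p,\alpha}$ and $L_{q,\beta}$. For a finite set of angles $U$ containing $0$, put $M_1(U)=\{[\![0,1]\!]_{\alpha,\beta}:\alpha,\beta\in U,\ \alpha\neq\beta\}$ and, for $k>1$, $M_k(U)=\{[\![p,q]\!]_{\alpha,\beta}: p,q\in M_{k-1}(U),\ \alpha,\beta\in U,\ \alpha\ne\beta\}$. The origami set is $M(U)=\bigcup_k M_k(U)$. The point group $P(U)$ is the group of those rotations about the origin and reflections across lines through the origin under which both $U$ and $M(U)$ are closed. Rotation by $\theta$ sends an angle $\alpha$ to $\alpha+\theta$ (mod $\pi$); reflection across the angle $\theta$, i.e. across the line through the origin at angle $\theta$, sends $\alpha$ to $2\theta-\alpha$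 (mod $\pi$). *)

(* Defs.v *)
From HB Require Import structures.
From mathcomp Require Import all_boot all_order all_algebra all_fingroup.
From mathcomp Require Import all_solvable generic_quotient ring_quotient complex.
From mathcomp Require Import all_classical all_reals all_analysis.
From mathcomp Require Import ring lra.

Set Implicit Arguments.
Unset Strict Implicit.
Unset Printing Implicit Defensive.
Import Order.TTheory GRing.Theory Num.Theory.
Local Open Scope classical_set_scope.
Local Open Scope ring_scope.
Local Open Scope complex_scope.
Local Open Scope quotient_scope.

Definition pi_multiple (R : realType) : {pred R} :=
  fun x => x / pi \is a Num.int.

Lemma in_pi_multiple (R : realType) (x : R) :
  (x \in @pi_multiple R) = (x / pi \is a Num.int).
Proof. by []. Qed.

Lemma pi_multiple_zmod_closed (R : realType) : zmod_closed (@pi_multiple R).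
Proof.
split=> [|x y]; rewrite !in_pi_multiple ?mul0r ?rpred0 // mulrBl.
exact: rpredB.
Qed.

HB.instance Definition _ (R : realType) :=
  GRing.isZmodClosed.Build R (@pi_multiple R) (pi_multiple_zmod_closed R).

(* Angles modulo pi: the additive group R / pi Z. *)
Notation angle R := (Quotient.quot (@pi_multiple R)).

Section Origami.
Variable R : realType.
Local Notation C := R[i].

Definition angle_of (t : R) : angle R := \pi_(angle R) t.

Definition cis (t : R) : C := cos t +i* sin t.

Definition line (p : C) (t : R) : set C := range (fun r : R => p + r%:C * cis t).

(* The choice of representatives is irrelevant by [line_angle], and for [a <> b]
   the default 0 is never used by [crossingP]. *)
Definition crossing (p q : C) (a b : angle R) : C :=
  xget 0 (line p (repr a) `&` line q (repr b)).

Definition origami_first (U : set (angle R)) : set C :=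
  [set z | exists a b, [/\ U a, U b, a <> b & z = crossing 0 1 a b]].

Definition origami_next (U : set (angle R)) (M : set C) : set C :=
  [set z | exists p q a b,
     [/\ M p, M q, U a, U b & a <> b /\ z = crossing p q a b]].

(* M_k, for k >= 1; the value at k = 0 is not used. *)
Definition origami_stage (U : set (angle R)) (k : nat) : set C :=
  iter k.-1 (origami_next U) (origami_first U).

Definition origami_set (U : set (angle R)) : set C :=
  \bigcup_(k in [set k | (0 < k)%N]) origami_stage U k.

Definition rotation (t : R) (z : C) : C := cis t * z.

(* Reflection across the line through the origin at angle [t]: it is conjugate
   by [rotation t] to complex conjugation, hence z |-> e^(2it) conj(z). *)
Definition reflection (t : R) (z : C) : C := cis (t *+ 2) * conjc z.

Definition rotate_angle (t : R) (a : angle R) : angle R := a + angle_of t.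

Definition reflect_angle (t : R) (a : angle R) : angle R := angle_of (t *+ 2) - a.

Definition point_rotation (U : set (angle R)) (f : C -> C) : Prop :=
  exists t, [/\ f = rotation t, rotate_angle t @` U `<=` U
              & rotation t @` origami_set U `<=` origami_set U].

Definition point_reflection (U : set (angle R)) (f : C -> C) : Prop :=
  exists t, [/\ f = reflection t, reflect_angle t @` U `<=` U
              & reflection t @` origami_set U `<=` origami_set U].

(* The group law is composition of maps. *)
Definition point_group (U : set (angle R)) : set (C -> C) :=
  [set f | point_rotation U f \/ point_reflection U f].

Definition has_order (f : C -> C) (m : nat) : Prop :=
  [/\ (0 < m)%N, iter m f =1 id
    & forall k, (0 < k < m)%N -> ~ (iter k f =1 id)].

Definition highest_rotation_order (U : set (angle R)) (n : nat) : Prop :=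
  (exists2 f, point_rotation U f & has_order f n) /\
  (forall f m, point_rotation U f -> has_order f m -> (m <= n)%N).

Definition contains_reflections (U : set (angle R)) : Prop :=
  exists f, point_reflection U f.

Definition isomorphic_to (G : set (C -> C)) (gT : finGroupType) : Prop :=
  exists phi : gT -> C -> C,
    [/\ injective phi, (forall x y, phi (x * y)%g = phi x \o phi y)
      & range phi = G].

Definition cyclic_of_order (G : set (C -> C)) (n : nat) : Prop :=
  exists gT : finGroupType,
    [/\ cyclic [set: gT]%G, #|gT| = n & isomorphic_to G gT].

End Origami.

Section Facts.
Variable R : realType.
Implicit Types (p q z : R[i]) (r t u : R) (a b : angle R).

Lemma angle_of_eq t u : angle_of t = angle_of u <-> (t - u) / pi \is a Num.int.
Proof.
rewrite -in_pi_multiple Quotient.idealrBE; split=> [e|/eqP //].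
exact/eqP.
Qed.

Lemma sin_int_pi (k : int) : sin (k%:~R * pi) = 0 :> R.
Proof.
have H (n : nat) : sin (n%:R * pi) = 0 :> R.
  elim: n => [|n IH]; first by rewrite mul0r sin0.
  by rewrite -natr1 mulrDl mul1r sinDpi IH oppr0.
by case: k => n; rewrite ?NegzE ?mulrNz ?mulNr ?sinN ?H ?oppr0.
Qed.

Lemma sin_eq0_int t : sin t = 0 -> t / pi \is a Num.int.
Proof.
move=> s0; set k := Num.floor (t / pi).
have pi0 : 0 < pi :> R := pi_gt0 R.
have piN0 : pi != 0 :> R by rewrite gt_eqF.
have s0' : sin (t - k%:~R * pi) = 0 by rewrite sinB s0 sin_int_pi mul0r mulr0 subrr.
have /andP[h1 h2] : k%:~R <= t / pi < (k + 1)%:~R.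
  by rewrite /k floor_le floorD1_gt.
have : 0 <= t - k%:~R * pi by rewrite subr_ge0 -ler_pdivlMr.
rewrite le_eqVlt => /orP[/eqP e|y0].
  have -> : t = k%:~R * pi by apply/eqP; rewrite -subr_eq0 -e.
  by rewrite mulfK.
suff : 0 < sin (t - k%:~R * pi) by rewrite s0' ltxx.
apply: sin_gt0_pi; rewrite y0 /= ltrBlDl.
by move: h2; rewrite ltr_pdivrMr // intrD mulrDl mul1r.
Qed.

Lemma line_sub p t u : (t - u) / pi \is a Num.int -> line p t `<=` line p u.
Proof.
move=> /intrP[k hk] z [r _ <-]; exists (r * cos (k%:~R * pi)) => //.
have -> : t = u + k%:~R * pi.
  by rewrite -hk divfK ?gt_eqF ?pi_gt0 // addrC subrK.
rewrite rmorphM -mulrA; congr (_ + _ * _).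
rewrite /cis sinD cosD !sin_int_pi; apply/eqP; rewrite eq_complex /=.
by rewrite !mulr0 !mul0r !subr0 !addr0 mulrC eqxx mulrC eqxx.
Qed.

Lemma line_angle p t : line p (repr (angle_of t)) = line p t.
Proof.
have e : angle_of (repr (angle_of t)) = angle_of t by rewrite /angle_of reprK.
by apply/seteqP; split; apply: line_sub; apply/angle_of_eq; rewrite e.
Qed.

Lemma crossingP p q a b : a <> b ->
  line p (repr a) `&` line q (repr b) = [set crossing p q a b].
Proof.
move=> ab; set t := repr a; set u := repr b.
have D0 : sin (u - t) != 0.
  apply/eqP => /sin_eq0_int /angle_of_eq.
  by rewrite /angle_of /t /u !reprK => e; apply: ab.
have uniq z z' : (line p t `&` line q u) z -> (line p t `&` line q u) z' -> z = z'.
  move=> [[r _ <-] [s _ e1]] [[r' _ <-] [s' _ e2]].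
  have := e2; have := e1; case: (p) (q) => [p1 p2] [q1 q2].
  move/eqP; rewrite eq_complex /= => /andP[/eqP x1 /eqP y1].
  move/eqP; rewrite eq_complex /= => /andP[/eqP x2 /eqP y2].
  suff : (r - r') * sin (u - t) = 0.
    by move/eqP; rewrite mulf_eq0 (negPf D0) orbF subr_eq0 => /eqP ->.
  rewrite sinB.
  have h1 : (r - r') * cos t = (s - s') * cos u by lra.
  have h2 : (r - r') * sin t = (s - s') * sin u by lra.
  transitivity (sin u * ((r - r') * cos t) - cos u * ((r - r') * sin t)); first by ring.
  by rewrite h1 h2; ring.
have [z hz] : (line p t `&` line q u) !=set0.
  exists (p + (((complex.Re q - complex.Re p) * sin u
                - (complex.Im q - complex.Im p) * cos u) / sin (u - t))%:C
              * cis t).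
  split; first by eexists.
  exists (((complex.Re q - complex.Re p) * sin t
           - (complex.Im q - complex.Im p) * cos t) / sin (u - t)) => //.
  move: D0; rewrite sinB => D0.
  case: (p) (q) => [p1 p2] [q1 q2] /=.
  by apply/eqP; rewrite eq_complex /=; apply/andP; split; apply/eqP; field.
rewrite /crossing -/t -/u; apply/seteqP; split=> w /=.
  move=> hw; apply: uniq hw _; exact: (xgetPex 0 (ex_intro _ z hz)).
by move=> ->; apply: (xgetPex 0 (ex_intro _ z hz)).
Qed.

End Facts.

(* Main.v *)
(** The units [w] whose rotation lies in [P(U)] form a finite multiplicative
    set, since [w] is determined up to sign by the image of the angle [0] in
    [U].  By Lagrange its members are the [K]-th roots of unity, [K] being its
    cardinality, so one of them has order [K], and maximality gives [K = n].
    Two reflections differ by a rotation, so one reflection [s] and a primitive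
    rotation [r] produce every element of [P(U)] uniquely as [r^i s^b] with
    [i < n] and [b] in [{0, 1}].  The multiplication rule of these normal forms
    is that of any group of order [2n] on [x, y] with [x^n = y^2 = 1] and
    [y^-1 x y = x^-1]; the Klein group is the case [n = 2]. *)
Require Import Defs.
From mathcomp Require Import all_boot all_order all_algebra all_fingroup.
From mathcomp Require Import all_solvable complex.
From mathcomp Require Import all_classical all_reals all_analysis.
Import Order.TTheory GRing.Theory Num.Theory.
Local Open Scope classical_set_scope.
Local Open Scope ring_scope.

(** Lagrange's argument: multiplication by [x] is injective and maps [s] into itself, so it permutes
    [s]. The product of the elements of [s] is nonzero and is multiplied by [x ^+ size s] under this
    permutation. *)
Lemma unity_of_finite_mul_closed {F : fieldType} (s : seq F) (x : F) :
  uniq s -> 0 \notin s -> (forall y z, y \in s -> z \in s -> y * z \in s) ->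
  x \in s -> x ^+ size s = 1.
Proof.
move=> us s0 sM sx.
have x0 : x != 0 by apply: contraNneq s0 => <-.
have ux : uniq [seq x * y | y <- s] by rewrite map_inj_uniq //; apply: mulfI.
have sub : {subset [seq x * y | y <- s] <= s} by move=> _ /mapP[y sy ->]; apply: sM.
have [_ eqs] := uniq_min_size ux sub (eq_leq (esym (size_map _ _))).
have perm_s : perm_eq [seq x * y | y <- s] s by exact: uniq_perm.
have p0 : \prod_(y <- s) y != 0.
  by rewrite prodf_seq_neq0; apply/allP => y sy; apply: contraNneq s0 => <-.
have : \prod_(y <- [seq x * y | y <- s]) y = \prod_(y <- s) y by exact: perm_big.
rewrite big_map big_split /= big_const_seq count_predT iter_mulr mulr1.
by rewrite -[RHS]mul1r => /(mulIf p0).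
Qed.

(** * Composition of rotations and reflections *)

Section PointGroup.
Context {R : realType}.
Local Notation C := R[i].
Implicit Types (U : set (angle R)) (w v z : C) (s t : R).

Lemma conjcM w v : conjc (w * v) = conjc w * conjc v.
Proof. exact: rmorphM. Qed.

Lemma cisD s t : cis (s + t) = cis s * cis t.
Proof.
rewrite /cis cosD sinD; apply/eqP; rewrite eq_complex /= eqxx.
by rewrite addrC eqxx.
Qed.

Lemma cis_conj t : conjc (cis t) = cis (- t).
Proof. by rewrite /cis cosN sinN. Qed.

Lemma cis0 : cis 0 = 1 :> C.
Proof. by rewrite /cis cos0 sin0. Qed.

Lemma mul_cis_conj t : cis t * conjc (cis t) = 1.
Proof. by rewrite cis_conj -cisD subrr cis0. Qed.

Lemma cis_neq0 t : cis t != 0.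
Proof.
apply/eqP => e; have /eqP := mul_cis_conj t.
by rewrite e mul0r eq_sym oner_eq0.
Qed.

Lemma rotationE t : rotation t = *%R (cis t).
Proof. by []. Qed.

Lemma rotation_comp s t : rotation s \o rotation t = rotation (s + t).
Proof. by apply/funext => z; rewrite /rotation /= cisD mulrA. Qed.

(** A reflection depends on its axis through the doubled angle, so a rotation by [s] turns the axis
    by [s / 2] only. *)
Lemma rotation_reflection_comp s t :
  rotation s \o reflection t = reflection (t + s / 2).
Proof.
apply/funext => z; rewrite /rotation /reflection /= mulrnDl -[s / 2 *+ 2]mulr_natr.
by rewrite divfK ?pnatr_eq0 // [t *+ 2 + s]addrC (cisD s) mulrA.
Qed.

Lemma reflection_comp s t : reflection s \o reflection t = rotation ((s - t) *+ 2).
Proof.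
apply/funext => z; rewrite /rotation /reflection /= conjcM conjcK cis_conj.
by rewrite mulrA -cisD mulrnBl.
Qed.

Lemma reflectionK t : involutive (reflection t).
Proof.
move=> z; have := congr1 (fun f : C -> C => f z) (reflection_comp t t).
by rewrite /= subrr mul0rn /rotation cis0 mul1r.
Qed.

Lemma image_sub_comp {T : Type} (f g : T -> T) (A : set T) :
  f @` A `<=` A -> g @` A `<=` A -> (f \o g) @` A `<=` A.
Proof. by move=> fA gA _ [x Ax <-]; apply: fA; exists (g x) => //; apply: gA; exists x. Qed.

Lemma point_rotation_comp U f g :
  point_rotation U f -> point_rotation U g -> point_rotation U (f \o g).
Proof.
move=> [s [-> sU sM]] [t [-> tU tM]]; exists (s + t).
split; rewrite -?rotation_comp //; last exact: image_sub_comp.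
have -> : rotate_angle (s + t) = rotate_angle s \o rotate_angle t.
  apply/funext => a; rewrite /rotate_angle /= /angle_of.
  by rewrite raddfD /= addrA addrAC.
exact: image_sub_comp.
Qed.

Lemma point_rotation_reflection_comp U f g :
  point_rotation U f -> point_reflection U g -> point_reflection U (f \o g).
Proof.
move=> [s [-> sU sM]] [t [-> tU tM]]; exists (t + s / 2).
split; rewrite -?rotation_reflection_comp //; last exact: image_sub_comp.
have -> : reflect_angle (t + s / 2) = rotate_angle s \o reflect_angle t.
  apply/funext => a; rewrite /rotate_angle /reflect_angle /= /angle_of.
  rewrite mulrnDl -[s / 2 *+ 2]mulr_natr divfK ?pnatr_eq0 //.
  by rewrite raddfD /= addrAC.
exact: image_sub_comp.
Qed.

Lemma point_reflection_comp U f g :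
  point_reflection U f -> point_reflection U g -> point_rotation U (f \o g).
Proof.
move=> [s [-> sU sM]] [t [-> tU tM]]; exists ((s - t) *+ 2).
split; rewrite -?reflection_comp //; last exact: image_sub_comp.
have -> : rotate_angle ((s - t) *+ 2) = reflect_angle s \o reflect_angle t.
  apply/funext => a; rewrite /rotate_angle /reflect_angle /= /angle_of.
  by rewrite mulrnBl raddfB /= opprB addrC -addrA [- _ + a]addrC.
exact: image_sub_comp.
Qed.

(** * The rotations of the point group as roots of unity *)

(** A rotation is recorded by its complex multiplier, which turns composition into multiplication in
    a field. *)
Definition rotation_units U : set C := [set w | point_rotation U ( *%R w)].

Lemma rotation_units_cis U w :
  rotation_units U w -> exists2 t, w = cis t & rotate_angle t @` U `<=` U.
Proof.
move=> [t [e tU _]]; exists t => //.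
by have := congr1 (fun f : C -> C => f 1) e; rewrite /rotation !mulr1.
Qed.

(** Two representatives of an angle differ by a multiple of pi, where the sine vanishes and the
    cosine is 1 or -1. *)
Lemma cis_repr t :
  cis t = cis (generic_quotient.repr (angle_of t)) \/
  cis t = - cis (generic_quotient.repr (angle_of t)).
Proof.
set u := generic_quotient.repr _.
have /angle_of_eq/intrP[k hk] : angle_of t = angle_of u.
  by rewrite /angle_of /u generic_quotient.reprK.
have s0 : sin (t - u) = 0.
  by rewrite -(divfK (lt0r_neq0 (pi_gt0 R)) (t - u)) hk sin_int_pi.
have : cos (t - u) ^+ 2 == 1 ^+ 2.
  by rewrite expr1n -[X in _ == X](cos2Dsin2 (t - u)) s0 expr0n addr0.
have -> : cis t = (cos (t - u) +i* 0)%C * cis u by rewrite -s0 -cisD subrK.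
rewrite eqf_sqr => /orP[]/eqP->; [left; exact: mul1r|right].
by rewrite -[RHS]mulN1r; congr (_ * _); apply/eqP; rewrite eq_complex /= oppr0 !eqxx.
Qed.

Lemma finite_rotation_units U : finite_set U -> U 0 -> finite_set (rotation_units U).
Proof.
move=> Ufin U0.
pose c (a : angle R) : C := cis (generic_quotient.repr a).
have sub : rotation_units U `<=` c @` U `|` (fun a => - c a) @` U.
  move=> _ /rotation_units_cis[t -> tU].
  have Ut : U (angle_of t) by apply: tU; exists 0 => //; rewrite /rotate_angle add0r.
  by have [->|->] := cis_repr t; [left|right]; exists (angle_of t).
by apply: (sub_finite_set sub); rewrite finite_setU; split; apply: finite_image.
Qed.

Lemma has_orderP w n : has_order ( *%R w) n <-> n.-primitive_root w.
Proof.
have iter1 k : (iter k ( *%R w) =1 id) <-> w ^+ k = 1.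
  split=> [/(_ 1)|e z]; first by rewrite iter_mulr mulr1.
  by rewrite iter_mulr e mul1r.
split=> [[n0 /iter1 wn wlt]|pw].
  (* The exact order [m] of [w] divides [n]; if it were smaller, it would contradict the minimality
     of [n]. *)
  have [m pm mn] := prim_order_exists n0 wn.
  have := dvdn_leq n0 mn; rewrite leq_eqVlt => /orP[/eqP <- //|lt_mn].
  have [] := wlt m; first by rewrite (prim_order_gt0 pm).
  by apply/iter1; exact: prim_expr_order.
split; [exact: prim_order_gt0 pw | exact/iter1/prim_expr_order|].
move=> k /andP[k0 kn] /iter1/eqP; rewrite -(prim_order_dvd pw).
by move=> /(dvdn_leq k0); rewrite leqNgt kn.
Qed.

Lemma point_rotationP U n : finite_set U -> U 0 -> highest_rotation_order U n ->
  exists t, n.-primitive_root (cis t) /\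
    forall f, point_rotation U f <-> exists i : 'I_n, f = *%R (cis t ^+ i).
Proof.
move=> Ufin U0 [[_ [t [-> tU tM]] /has_orderP pw] nmax]; exists t; split=> //.
have n0 := prim_order_gt0 pw.
have /finite_seqP[s0 Es0] := finite_rotation_units _ Ufin U0.
pose s := undup s0.
have sP w : w \in s <-> point_rotation U ( *%R w).
  by rewrite mem_undup -[point_rotation _ _]/(rotation_units U w) Es0.
have st : cis t \in s by apply/sP; exists t.
have sM y z : y \in s -> z \in s -> y * z \in s.
  move=> /sP ys /sP zs; apply/sP.
  have -> : *%R (y * z) = *%R y \o *%R z by apply/funext => x /=; rewrite mulrA.
  exact: point_rotation_comp.
have sN0 : 0 \notin s.
  apply/negP => /sP/rotation_units_cis[u e _].
  by have := cis_neq0 u; rewrite -e eqxx.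
have us : uniq s := undup_uniq s0.
have unity x : x \in s -> x ^+ size s = 1 by exact: unity_of_finite_mul_closed.
have size_gt0 : (0 < size s)%N by case: (s) st.
(* As many distinct roots of unity as their common exponent must include a primitive one. *)
have /hasP[z zs pz] : has (size s).-primitive_root s.
  apply: has_prim_root => //; apply/allP => x xs; apply/unity_rootP; exact: unity.
(* [size s] is at most [n] by maximality, as [z] has that order; and [n] divides it, as [cis t] lies
   in [s]. *)
have sn : size s = n.
  apply/eqP; rewrite eqn_leq (nmax _ _ ((sP z).1 zs)); last exact/has_orderP.
  by rewrite dvdn_leq // (prim_order_dvd pw) unity.
move=> f; split=> [pf|[i ->]].
  have [u [fu _ _]] := pf.
  have us' : cis u \in s by apply/sP; rewrite -rotationE -fu.
  have := unity _ us'; rewrite sn => /(prim_rootP pw)[i e].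
  by exists i; rewrite fu rotationE e.
apply/sP; elim: (nat_of_ord i) => [|k IH]; last by rewrite exprS; exact: sM.
(* The exponent 0 is traded for [n], so that the identity too is a product of copies of [cis t]. *)
have [k ->] : exists k, cis t ^+ 0 = cis t ^+ k.+1.
  by exists n.-1; rewrite prednK // (prim_expr_order pw) expr0.
by elim: k => [|k IH]; [rewrite expr1 | rewrite exprS; exact: sM].
Qed.

Lemma rotations_cyclic (G : set (C -> C)) n w : (1 < n)%N -> n.-primitive_root w ->
  (forall f, G f <-> exists i : 'I_n, f = *%R (w ^+ i)) -> cyclic_of_order G n.
Proof.
move=> n1 pw GP; exists 'Z_n; split.
- by apply/cyclicP; exists Zp1; exact: Zp_cycle.
- by rewrite card_ord Zp_cast.
have lt_n (i : 'Z_n) : (i < n)%N by have := ltn_ord i; rewrite {2}Zp_cast.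
exists (fun i : 'Z_n => *%R (w ^+ i)); split.
- move=> i j /(congr1 (fun f : C -> C => f 1)); rewrite !mulr1 => /eqP.
  by rewrite (eq_prim_root_expr pw) !modn_small // => /eqP/val_inj.
- move=> i j; apply/funext => z /=; rewrite mulrA -exprD; congr (_ * _).
  by rewrite [X in (_ %% X)%N]Zp_cast // (prim_expr_mod pw).
apply/seteqP; split=> [_ [i _ <-]|f /GP[i ->]].
  by apply/GP; exists (Ordinal (lt_n i)).
have lt_i : (i < (Zp_trunc n).+2)%N by rewrite Zp_cast.
by exists (Ordinal lt_i).
Qed.

(** * Normal forms and the isomorphism criterion *)

(** This is [r^i s^b], where [r] multiplies by [w] and [s] sends [z] to [v * conjc z]. *)
Definition normal_form w v (i : nat) (b : bool) (z : C) : C :=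
  w ^+ i * (if b then v * conjc z else z).

(** Moving the conjugation past [w ^+ j] inverts it; [j * n.-1] is the exponent [- j] modulo [n],
    kept natural. *)
Lemma normal_form_comp n w v i j (b c : bool) :
  (0 < n)%N -> w ^+ n = 1 -> w * conjc w = 1 -> v * conjc v = 1 ->
  normal_form w v i b \o normal_form w v j c =
  normal_form w v (i + (if b then j * n.-1 else j)) (b (+) c).
Proof.
move=> n0 wn ww vv; apply/funext => z; rewrite /normal_form /=.
have wj : conjc (w ^+ j) = w ^+ (j * n.-1).
  have w0 : w ^+ j != 0.
    rewrite expf_neq0 //; apply/eqP => w0; move/eqP: ww.
    by rewrite w0 mul0r eq_sym oner_eq0.
  apply: (mulfI w0); rewrite -exprD -mulnS prednK // mulnC exprM wn expr1n.
  by rewrite rmorphXn -exprMn ww expr1n.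
rewrite exprD -mulrA; congr (_ * _).
case: b => //=; case: c => /=; rewrite conjcM wj; last by rewrite mulrCA.
by rewrite conjcM conjcK mulrCA (mulrA v) vv mul1r.
Qed.

Lemma normal_form_inj n w v i j (b c : bool) : (i < n)%N -> (j < n)%N ->
  n.-primitive_root w -> v != 0 ->
  normal_form w v i b = normal_form w v j c -> i = j /\ b = c.
Proof.
move=> lt_i lt_j pw v0 e.
have e1 := congr1 (fun f : C -> C => f 1) e.
have eI := congr1 (fun f : C -> C => f 'i%C) e.
have w0 k : w ^+ k != 0.
  rewrite expf_neq0 // (prim_root_eq0 pw) -lt0n.
  exact: leq_trans lt_i.
have ij : w ^+ i = w ^+ j -> i = j.
  by move=> /eqP; rewrite (eq_prim_root_expr pw) !modn_small // => /eqP.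
have iN0 : 'i%C != 0 :> C by rewrite eq_complex /= oner_eq0 andbF.
have conjI : conjc 'i%C = - 'i%C :> C by apply/eqP; rewrite eq_complex /= oppr0 !eqxx.
(* A conjugating and a non-conjugating form that agree at 1 and at ['i] would force [- 'i = 'i]. *)
have twist k l :
    w ^+ k * v = w ^+ l -> w ^+ k * (v * - 'i%C) = w ^+ l * 'i%C -> False.
  rewrite mulrA => -> /(mulfI (w0 l))/eqP.
  by rewrite -subr_eq0 -opprD oppr_eq0 -mulr2n mulrn_eq0 (negPf iN0).
move: e1 eI; rewrite /normal_form conjc1 conjI.
case: b c {e} => -[]; rewrite ?mulr1.
- by move=> /(mulIf v0)/ij.
- by move=> e1 /(twist _ _ e1).
- by move=> /esym e1 /esym/(twist _ _ e1).
- by move=> /ij.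
Qed.

(** The products [x^i y^b] exhaust [gT], and there are as many pairs [(i, b)] as elements, so each
    element has unique exponents. Sending it to the normal form with these exponents respects
    products because both multiplication rules agree. *)
Lemma normal_form_isomorphic (G : set (C -> C)) (gT : finGroupType) (x y : gT) n w v :
  n.-primitive_root w -> w * conjc w = 1 -> v * conjc v = 1 ->
  (forall f, G f <-> exists (i : 'I_n) b, f = normal_form w v i b) ->
  #|gT| = n.*2 -> (x ^+ n = 1)%g -> (y ^+ 2 = 1)%g -> (x ^ y = x^-1)%g ->
  (<[x]> * <[y]> = [set: gT]%SET)%g -> isomorphic_to G gT.
Proof.
move=> pw ww vv GP card_gT xn y2 xy gen.
have n0 := prim_order_gt0 pw.
have v0 : v != 0.
  by apply/eqP => v0; move/eqP: vv; rewrite v0 mul0r eq_sym oner_eq0.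
pose F (p : 'I_n * bool) : gT := (x ^+ p.1 * y ^+ p.2)%g.
pose red k : 'I_n := Ordinal (ltn_pmod k n0).
have F_red k b : F (red k, b) = (x ^+ k * y ^+ b)%g by rewrite /F /= expg_mod.
have F_surj g : exists p, g = F p.
  have : g \in [set: gT]%SET by rewrite inE.
  rewrite -gen => /mulsgP[_ _ /cycleP[k ->] /cycleP[l ->] ->].
  by exists (red k, odd l); rewrite F_red -modn2 expg_mod.
have F_inj : injective F.
  have /imset_injP F_inj : #|F @: [set: _]%SET| == #|[set: 'I_n * bool]%SET|.
    have -> : F @: [set: _]%SET = [set: gT]%SET.
      apply/setP => g; rewrite inE; have [p ->] := F_surj g.
      by apply: imset_f; rewrite inE.
    by rewrite !cardsT card_gT card_prod card_ord card_bool muln2.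
  by move=> p q; apply: F_inj; rewrite inE.
have [|h FK hK] := inj_card_bij F_inj.
  by rewrite card_gT card_prod card_ord card_bool muln2.
(* This is the rule of [normal_form_comp], with conjugation by [y] in the role of complex
   conjugation. *)
have FM p q : (F p * F q)%g =
    F (red (p.1 + (if p.2 then q.1 * n.-1 else q.1))%N, p.2 (+) q.2).
  case: p q => [i b] [j c]; rewrite F_red /F /= expgD.
  case: b => /=; last by rewrite expg0 mulg1 mulgA.
  have -> : (x ^+ (j * n.-1) = (x ^+ j) ^ y)%g.
    rewrite mulnC expgM conjXg xy; congr (_ ^+ _)%g.
    by apply/eqP; rewrite eq_sym eq_invg_mul -expgS prednK // xn.
  rewrite conjgE expg1 -(mulg1 (y^-1)%g) -y2.
  have -> : (y^-1 * y ^+ 2 = y)%g by rewrite expgS expg1 mulKg.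
  rewrite -!mulgA; congr (_ * (_ * (_ * _)))%g.
  (* What remains is [y^c = y * y^(1 - c)], by [y^2 = 1]. *)
  by case: c; rewrite /= ?expg0 ?mulg1 ?expg1 // -y2 expgS expg1.
exists (fun g => normal_form w v (h g).1 (h g).2); split.
- move=> g g' /(normal_form_inj _ _ _ _ _ _ _ (ltn_ord _) (ltn_ord _) pw v0)[e1 e2].
  by apply: (can_inj hK); move: e1 e2; case: (h g) (h g') => ? ? [? ?] /= /val_inj-> ->.
- move=> g g'; rewrite (normal_form_comp n) //; last exact: prim_expr_order.
  have := FM (h g) (h g'); rewrite !hK => ->; rewrite FK.
  by rewrite /normal_form /= (prim_expr_mod pw).
apply/seteqP; split=> [_ [g _ <-]|f /GP[i [b ->]]]; first by apply/GP; do 2 eexists.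
by exists (F (i, b)) => //; rewrite FK.
Qed.

Lemma point_groupP U n w u : n.-primitive_root w -> point_reflection U (reflection u) ->
  (forall f, point_rotation U f <-> exists i : 'I_n, f = *%R (w ^+ i)) ->
  forall f, point_group U f <->
    exists (i : 'I_n) b, f = normal_form w (cis (u *+ 2)) i b.
Proof.
move=> pw pu rotP f.
have nfT i : normal_form w (cis (u *+ 2)) i true = *%R (w ^+ i) \o reflection u by [].
split=> [[/rotP[i ->]|pf]|[i [[]->]]].
- by exists i, false.
(* [f] composed with the fixed reflection is a rotation; composing with that involution again
   recovers [f]. *)
- have /rotP[i e] := point_reflection_comp _ _ _ pf pu; exists i, true.
  by rewrite nfT -e; apply/funext => z /=; rewrite reflectionK.
- by right; rewrite nfT; apply: point_rotation_reflection_comp => //; apply/rotP; exists i.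
- by left; apply/rotP; exists i.
Qed.

End PointGroup.

(** * Generators of the dihedral and Klein groups *)

(** The index [n.*2] is the order of the group. Its presentation supplies [x] and [y], and the
    generated group is a product of cyclic groups since [y] normalizes [<[x]>]. *)
Lemma dihedral_generators n : (1 < n)%N -> exists x y : dihedral_gtype n.*2,
  [/\ x ^+ n = 1, y ^+ 2 = 1, x ^ y = x^-1
    & <[x]> * <[y]> = [set: _]%SET]%g.
Proof.
move=> n1; have := homg_refl [set: dihedral_gtype n.*2]%SET.
rewrite Grp_dihedral // => /existsP[[x y]] /=.
rewrite !xpair_eqE => /and4P[/eqP gen /eqP xn /eqP y2 /eqP xy].
exists x, y; split=> //; rewrite -gen -norm_joinEr //.
by rewrite norms_cycle xy groupV cycle_id.
Qed.

Lemma klein_generators : exists x y : 'Z_2 * 'Z_2,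
  [/\ x ^+ 2 = 1, y ^+ 2 = 1, x ^ y = x^-1
    & <[x]> * <[y]> = [set: _]%SET]%g.
Proof.
(* [1%g] is the neutral element, that is the residue 0; [Zp1] is the generator. *)
exists (Zp1, 1%g), (1%g, Zp1); split; try exact/eqP.
apply/setP => -[a b]; rewrite inE; apply/mulsgP.
exists ((Zp1 : 'Z_2, 1 : 'Z_2) ^+ a)%g ((1 : 'Z_2, Zp1 : 'Z_2) ^+ b)%g; rewrite ?mem_cycle //.
by move: a b => [[|[|//]] ?] [[|[|//]] ?]; apply/eqP.
Qed.

Theorem theorem5 (R : realType) (U : set (angle R)) (n : nat)
    (Ufin : finite_set U) (U0 : U 0) (hn : highest_rotation_order U n) :
  ((2 < n)%N ->
     (~ contains_reflections U -> cyclic_of_order (point_group U) n) /\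
     (contains_reflections U ->
        isomorphic_to (point_group U) 'D_(n.*2)%type)) /\
  (n = 2%N ->
     (~ contains_reflections U -> cyclic_of_order (point_group U) 2) /\
     (contains_reflections U ->
        isomorphic_to (point_group U) ('Z_2 * 'Z_2)%type)).
Proof.
have [t [pw rotP]] := point_rotationP _ _ Ufin U0 hn.
have cyc : (1 < n)%N -> ~ contains_reflections U -> cyclic_of_order (point_group U) n.
  move=> n1 no_refl; apply: (rotations_cyclic _ _ _ n1 pw) => f; apply: (iff_trans _ (rotP f)).
  by split=> [[//|pf]|pf]; [case: no_refl; exists f | left].
(* The dihedral and Klein cases differ only in the generators supplied here. *)
have dih (gT : finGroupType) (x y : gT) : contains_reflections U ->
    #|gT| = n.*2 -> (x ^+ n = 1)%g -> (y ^+ 2 = 1)%g -> (x ^ y = x^-1)%g ->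
    (<[x]> * <[y]> = [set: gT]%SET)%g -> isomorphic_to (point_group U) gT.
  move=> [f [u [_ uU uM]]].
  apply: (normal_form_isomorphic _ _ _ _ _ _ _ pw (mul_cis_conj t) (mul_cis_conj (u *+ 2))).
  by apply: point_groupP => //; exists u.
split=> [n2|n2]; split=> [no_refl|refl].
- by apply: cyc => //; apply: ltnW.
- have n1 := ltnW n2; have [x [y [xn y2 xy gen]]] := dihedral_generators _ n1.
  by apply: (dih _ x y) => //; rewrite -cardsT card_dihedral.
- by rewrite -n2; apply: cyc => //; rewrite n2.
- have [x [y [xn y2' xy gen]]] := klein_generators.
  by apply: (dih _ x y) => //; rewrite n2 // card_prod card_ord.
Qed.
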